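(* Let $I$ and $O$ be finite disjoint sets of input and output propositions, let $AP = I \cup O$, let $\varphi$ be an LTL-formula over $AP$, and let $\mathcal{T}$ be a $2^O$-labeled $2^I$-transition system. For every minimal repair $\xi$ for $\mathcal{T}$ and $\varphi$, there exists an explanation for $\varphi$, $\mathcal{T}$ and $\xi$.
   Context: **LTL.** Linear-time temporal logic over $AP$ has the usual semantics over infinite sequences $\sigma : \mathbb{N} \to 2^{AP}$. Write $\sigma \vDash \varphi$ for satisfaction and $\mathcal{L}(\varphi) = \{\sigma : \mathbb{N} \to 2^{AP} \mid \sigma \vDash \varphi\}$. **Transition systems.** A $2^O$-labeled $2^I$-transition system is a tuple $\mathcal{T} = (T, t_0, \tau, o)$ with a finite set of states $T$, an initial state $t_0 \in T$, a transition function $\tau : T \times 2^I \to T$, and a labeling function $o : T \to 2^O$. States need not be reachable from $t_0$. An initial path is a sequence $\pi : \mathbb{N} \to T \times 2^I$, $\pi(i) = (t_i, e_i)$, starting in the initial state $t_0$ of $\mathcal{T}$ and satisfying $t_{i+1} = \tau(t_i, e_i)$ for all $i$. Its trace is the sequence $i \mapsto o(t_i) \cup e_i$. The language $\mathcal{L}(\mathcal{T})$ is the set of traces of all initial paths. $\mathcal{T} \vDash \varphi$ means $\mathcal{L}(\mathcal{T}) \subseteq \mathcal{L}(\varphi)$. **Operations.** An operation $\Delta$ on $\mathcal{T}$ is one of the following. - A state labeling change $(t, v)$ with $t \in T$, $v \in 2^O$. Then $\mathit{apply}(\mathcal{T}, \Delta) = (T, t_0, \tau, o')$ with $o'(t)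 = v$ and $o'(t') = o(t')$ for $t' \neq t$. - A transition redirection $(t, t', V)$ with $t, t' \in T$, $V \subseteq 2^I$. Then $\mathit{apply}(\mathcal{T}, \Delta) = (T, t_0, \tau', o)$ with $\tau'(t, v) = t'$ for $v \in V$, $\tau'(t, v) = \tau(t, v)$ for $v \notin V$, and $\tau'(t'', v) = \tau(t'', v)$ for all $t'' \neq t$ and $v \in 2^I$. No operation adds states; the state set $T$ is fixed. **Transformations.** A transformation $\xi$ is a finite set of operations. It is consistent if there is no transition system $\mathcal{T}$ and no $\Delta_1, \Delta_2 \in \xi$ with $\mathit{apply}(\mathit{apply}(\mathcal{T}, \Delta_1), \Delta_2) \neq \mathit{apply}(\mathit{apply}(\mathcal{T}, \Delta_2), \Delta_1)$. For consistent $\xi$, $\mathit{apply}^*(\mathcal{T}, \xi)$ is the transition system obtained from $\mathcal{T}$ by applying every operation in $\xi$ (the order is irrelevant). **Minimal repair.** A consistent transformation $\xi$ is a repair for $\mathcal{T}$ and $\varphi$ if $\mathit{apply}^*(\mathcal{T}, \xi) \vDash \varphi$. A repair $\xi$ is minimal if there is no repair $\xi'$ for $\mathcal{T}$ and $\varphi$ with $|\xi'| < |\xi|$. **Justification.** A transformation $\xi$ for $\mathcal{T}$ (and $\varphi$) is justified by $\sigma : \mathbb{N} \to 2^{AP}$ if $\sigma \nvDash \varphi$, $\sigma \in \mathcal{L}(\mathcal{T})$ and $\sigma \notin \mathcal{L}(\mathit{apply}^*(\mathcal{T}, \xi))$. It is minimally justified by $\sigma$ if it is justified by $\sigma$ and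 there is no proper subset $\xi' \subset \xi$ that is justified by $\sigma$ for $\mathcal{T}$ and $\varphi$. **Explanation.** For $\varphi$, $\mathcal{T}$ and a minimal repair $\xi$, an explanation is a finite sequence (empty when $\xi = \emptyset$) of pairs $(\xi_1, \sigma_1), \dots, (\xi_n, \sigma_n)$ of transformations and sequences $\sigma_i : \mathbb{N} \to 2^{AP}$ such that the transformations $\xi_1, \dots, \xi_n$ are pairwise disjoint, $\xi = \bigcup_{1 \leq i \leq n} \xi_i$, and for each $1 \leq i \leq n$ the transformation $\xi_i$ is minimally justified by $\sigma_i$ for the transition system $\mathit{apply}^*(\mathcal{T}, \bigcup_{1 \leq j < i} \xi_j)$ and $\varphi$. *)

(* Defs.v *)
From HB Require Import structures.
From mathcomp Require Import all_boot.

Set Implicit Arguments.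
Unset Strict Implicit.
Unset Printing Implicit Defensive.

(* Infinite sequences nat -> 2^AP. *)
Definition word (AP : finType) := nat -> {set AP}.

(* The other boolean and temporal operators are the usual abbreviations, e.g.
   F phi := true U phi, G phi := ~ F ~ phi. *)
Inductive ltl (AP : finType) :=
| LTrue
| LAtom of AP
| LNot of ltl AP
| LAnd of ltl AP & ltl AP
| LNext of ltl AP
| LUntil of ltl AP & ltl AP.

Arguments LTrue {AP}.

Definition suffix_from (AP : finType) (sigma : word AP) (k : nat) : word AP :=
  fun i => sigma (k + i).

Fixpoint sat (AP : finType) (sigma : word AP) (phi : ltl AP) : Prop :=
  match phi with
  | LTrue => True
  | LAtom p => p \in sigma 0
  | LNot phi1 => ~ sat sigma phi1
  | LAnd phi1 phi2 => sat sigma phi1 /\ sat sigma phi2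
  | LNext phi1 => sat (suffix_from sigma 1) phi1
  | LUntil phi1 phi2 =>
      exists k, sat (suffix_from sigma k) phi2 /\
        forall j, j < k -> sat (suffix_from sigma j) phi1
  end.

Section TransitionSystems.

(* The disjoint union AP of I and O is the sum type I + O. *)
Variables I O S : finType.

(* The state set S is a parameter, since operations never change it. The
   transition and labeling functions are finite functions, so that Leibniz
   equality of transition systems is extensional. *)
Record tsystem := TSystem {
  init : S;
  trans : {ffun S * {set I} -> S};
  label : {ffun S -> {set O}}
}.

Definition initial_path (T : tsystem) (pi : nat -> S * {set I}) : Prop :=
  (pi 0).1 = init T /\ forall i, (pi i.+1).1 = trans T (pi i).

Definition trace (T : tsystem) (pi : nat -> S * {set I}) : word (I + O)%type :=
  fun i => (inr @: label T (pi i).1) :|: (inl @: (pi i).2).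

Definition lang (T : tsystem) (sigma : word (I + O)%type) : Prop :=
  exists2 pi, initial_path T pi & sigma =1 trace T pi.

Definition models (T : tsystem) (phi : ltl (I + O)%type) : Prop :=
  forall sigma, lang T sigma -> sat sigma phi.

Inductive operation :=
| Relabel of S & {set O}
| Redirect of S & S & {set {set I}}.

Definition operation_code (D : operation) :
    (S * {set O}) + (S * S * {set {set I}}) :=
  match D with
  | Relabel t v => inl (t, v)
  | Redirect t t' V => inr (t, t', V)
  end.

Definition operation_decode (c : (S * {set O}) + (S * S * {set {set I}})) :
    operation :=
  match c with
  | inl (t, v) => Relabel t v
  | inr (t, t', V) => Redirect t t' V
  end.

Lemma operation_codeK : cancel operation_code operation_decode.
Proof. by case. Qed.

HB.instance Definition _ := Finite.copy operation (can_type operation_codeK).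

Definition apply_op (T : tsystem) (D : operation) : tsystem :=
  match D with
  | Relabel t v =>
      TSystem (init T) (trans T) [ffun s => if s == t then v else label T s]
  | Redirect t t' V =>
      TSystem (init T)
        [ffun se => if (se.1 == t) && (se.2 \in V) then t' else trans T se]
        (label T)
  end.

Definition transformation := {set operation}.

Definition consistent (xi : transformation) : Prop :=
  forall (T : tsystem) (D1 D2 : operation), D1 \in xi -> D2 \in xi ->
    apply_op (apply_op T D1) D2 = apply_op (apply_op T D2) D1.

(* Only meaningful for consistent xi, for which the enumeration order does not
   matter: see apply_starE. *)
Definition apply_star (T : tsystem) (xi : transformation) : tsystem :=
  foldl apply_op T (enum xi).

Lemma foldl_apply_op_perm (xi : transformation) (s1 s2 : seq operation)
    (T : tsystem) :
  consistent xi -> {subset s1 <= xi} -> perm_eq s1 s2 ->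
  foldl apply_op T s1 = foldl apply_op T s2.
Proof.
move=> cxi; elim: s1 s2 T => [|D s1 IHs] s2 T sub_s1 eq_s12.
  by move: eq_s12; rewrite perm_sym => /perm_nilP ->.
have move_front p q T' : {subset D :: p <= xi} ->
    foldl apply_op T' (D :: p ++ q) = foldl apply_op T' (p ++ D :: q).
  elim: p T' => //= E p IHp T' sub_p.
  rewrite cxi; [|by apply: sub_p; rewrite !inE eqxx ?orbT..].
  apply: IHp => x; rewrite inE => /orP[/eqP ->|x_p]; apply: sub_p.
    by rewrite inE eqxx.
  by rewrite !inE x_p !orbT.
have D_s2 : D \in s2 by rewrite -(perm_mem eq_s12) inE eqxx.
case/splitPr: D_s2 eq_s12 => p q eq_s12.
have sub_pq : {subset p ++ D :: q <= xi}.
  by move=> x; rewrite -(perm_mem eq_s12); apply: sub_s1.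
rewrite -move_front; last first.
  move=> x x_p; apply: sub_pq; move: x_p.
  by rewrite mem_cat !inE => /orP[] ->; rewrite ?orbT.
apply: IHs; first by move=> x x_s; apply: sub_s1; rewrite inE x_s orbT.
rewrite -(perm_cons D) (perm_trans eq_s12) //.
by rewrite (permEl (perm_catCA p [:: D] q)).
Qed.

Lemma apply_starE (T : tsystem) (xi : transformation) (s : seq operation) :
  consistent xi -> uniq s -> s =i xi -> apply_star T xi = foldl apply_op T s.
Proof.
move=> cxi uniq_s eq_s; apply: (foldl_apply_op_perm _ cxi).
  by move=> x; rewrite mem_enum.
by apply: uniq_perm => // [|x]; rewrite ?enum_uniq // mem_enum eq_s.
Qed.

Variable phi : ltl (I + O)%type.

Definition repair (T : tsystem) (xi : transformation) : Prop :=
  consistent xi /\ models (apply_star T xi) phi.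

Definition minimal_repair (T : tsystem) (xi : transformation) : Prop :=
  repair T xi /\ ~ (exists2 xi', repair T xi' & #|xi'| < #|xi|).

Definition justified (T : tsystem) (xi : transformation)
    (sigma : word (I + O)%type) : Prop :=
  [/\ ~ sat sigma phi, lang T sigma & ~ lang (apply_star T xi) sigma].

Definition minimally_justified (T : tsystem) (xi : transformation)
    (sigma : word (I + O)%type) : Prop :=
  justified T xi sigma /\
  ~ (exists2 xi' : transformation, xi' \proper xi & justified T xi' sigma).

Definition explanation (T : tsystem) (xi : transformation) (n : nat)
    (E : 'I_n -> transformation * word (I + O)%type) : Prop :=
  [/\ forall i j, i != j -> [disjoint (E i).1 & (E j).1],
      xi = \bigcup_(i < n) (E i).1
    & forall i : 'I_n,
        minimally_justified (apply_star T (\bigcup_(j < n | j < i) (E j).1))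
          (E i).1 (E i).2].

End TransitionSystems.

(* Main.v *)
Require Import Defs.
From mathcomp Require Import all_boot.
From Stdlib Require Import Classical.

(** Call a consistent transformation irredundant if it is a repair but no
    proper subset of it is; minimal repairs are irredundant. If [xi] is
    nonempty and irredundant for [T], then [T] has a trace violating [phi], and
    [xi] is justified by this trace. A minimal justified subset [xi1] is
    nonempty, and [xi :\: xi1] is irredundant for [apply_star T xi1], so that
    induction on the cardinal of [xi] yields the rest of the explanation. *)

Lemma minimal_subset_ex (X : finType) (P : {set X} -> Prop) (A : {set X}) :
  P A -> exists B : {set X},
    [/\ B \subset A, P B & ~ (exists2 C : {set X}, C \proper B & P C)].
Proof.
have [n] := ubnP #|A|; elim: n A => // n IHn A leAn PA.
(* [P] need not be decidable, so the case split is classical; the descent ends because cardinals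
   drop. *)
have [[C ltCA PC]|minA] := classic (exists2 C : {set X}, C \proper A & P C).
  have [|B [sBC PB minB]] := IHn C _ PC.
    by apply: leq_trans (proper_card ltCA) _.
  by exists B; split=> //; apply: subset_trans sBC (proper_sub ltCA).
by exists A.
Qed.

Section Explanation.

Variables (I O S : finType) (phi : ltl (I + O)%type).
Implicit Types (T : tsystem I O S) (A B xi : transformation I O S).

Lemma consistent_sub {A B} : A \subset B -> consistent B -> consistent A.
Proof. by move=> /subsetP sAB cB T D1 D2 /sAB D1B /sAB D2B; apply: cB. Qed.

Lemma apply_star0 T : apply_star T set0 = T.
Proof. by rewrite /apply_star enum_set0. Qed.

(** Enumerating [A] and then [B] lists [A :|: B] without repetition, and consistency makes the order
    irrelevant. *)
Lemma apply_starU T {A B} : consistent (A :|: B) -> [disjoint A & B] ->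
  apply_star T (A :|: B) = apply_star (apply_star T A) B.
Proof.
move=> cAB dAB; rewrite {2 3}/apply_star -foldl_cat; apply: apply_starE => //.
  rewrite cat_uniq !enum_uniq /= andbT; apply/hasPn => D; rewrite !mem_enum.
  by move=> DB; rewrite (disjointFl dAB DB).
by move=> D; rewrite mem_cat !mem_enum inE.
Qed.

Lemma justified_neq0 {T A sigma} : justified phi T A sigma -> A != set0.
Proof.
by case=> _ Lsigma nLsigma; apply/eqP => A0; apply: nLsigma; rewrite A0 apply_star0.
Qed.

(** Any trace of [T] violating [phi] will do: all traces of the repaired system satisfy [phi]. *)
Lemma justified_repair_ex {T xi} : models (apply_star T xi) phi ->
  ~ models T phi -> exists sigma, justified phi T xi sigma.
Proof.
move=> mxi nmT; have [sigma nsigma] := not_all_ex_not _ _ nmT.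
have [Lsigma nsat] := imply_to_and _ _ nsigma.
by exists sigma; split=> // /mxi.
Qed.

Lemma explanation_empty T : exists (n : nat)
    (E : 'I_n -> transformation I O S * word (I + O)%type),
  explanation phi T set0 E.
Proof.
exists 0, (fun=> (set0, fun=> set0)); split=> [[]||[]] //.
by rewrite big_ord0.
Qed.

(** The pair for [A] goes to index [ord0] and [E] is shifted by one; [apply_starU] identifies the
    intermediate systems. *)
Lemma explanation_cons {T A B sigma n}
    {E : 'I_n -> transformation I O S * word (I + O)%type} :
  consistent (A :|: B) -> [disjoint A & B] -> minimally_justified phi T A sigma ->
  explanation phi (apply_star T A) B E ->
  explanation phi T (A :|: B)
    (fun i : 'I_n.+1 => if unlift ord0 i is Some j then E j else (A, sigma)).
Proof.
move=> cAB dAB mjA [dE defB mjE].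
have sEB j : (E j).1 \subset B by rewrite defB; apply: (bigcup_sup j).
split=> [i j||i].
- case: (unliftP ord0 i) => [i' ->|->]; case: (unliftP ord0 j) => [j' ->|->] //=.
  + by rewrite (inj_eq lift_inj); apply: dE.
  + by rewrite disjoint_sym => _; apply: disjointWr (sEB i') dAB.
  + by move=> _; apply: disjointWr (sEB j') dAB.
- rewrite big_ord_recl unlift_none; congr (_ :|: _).
  by rewrite defB; apply: eq_bigr => j _; rewrite liftK.
case: (unliftP ord0 i) => [i' ->|->] /=; last first.
  by rewrite big_pred0 // apply_star0.
set U := \bigcup_(j < n | j < i') (E j).1.
have sUB : U \subset B by apply/bigcupsP.
(* The indices below [lift ord0 i'] are [ord0], which contributes [A], and the shifts of all
   [j < i'], which contribute [U]. *)
rewrite big_mkcond big_ord_recl /= unlift_none.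
rewrite (_ : \bigcup_(j < n) _ = U); last first.
  rewrite /U [RHS]big_mkcond; apply: eq_bigr => j _.
  by rewrite liftK /bump /= !add1n ltnS.
rewrite apply_starU; first exact: mjE.
  exact: consistent_sub (setUS A sUB) cAB.
exact: disjointWr sUB dAB.
Qed.

(** Subsets of [xi] inherit consistency, whereas a smaller repair of [apply_star T A] may conflict
    with [A]; hence the induction carries irredundance instead of minimality in cardinal. *)
Lemma explanation_ex T xi :
  repair phi T xi -> (forall A, A \proper xi -> ~ models (apply_star T A) phi) ->
  exists (n : nat) (E : 'I_n -> transformation I O S * word (I + O)%type),
    explanation phi T xi E.
Proof.
have [m] := ubnP #|xi|; elim: m T xi => // m IHm T xi lexim [cxi mxi] irr.
have [->|xi_n0] := eqVneq xi set0; first exact: explanation_empty.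
have nmT : ~ models T phi.
  by rewrite -[T]apply_star0; apply: irr; rewrite proper0.
have [sigma /(minimal_subset_ex _ (fun A => justified phi T A sigma))] :=
  justified_repair_ex mxi nmT.
case=> A [sAxi jA minA].
have A_n0 := justified_neq0 jA.
have dA : [disjoint A & xi :\: A].
  by rewrite disjoint_sym disjoints_subset subsetDr.
have defxi : A :|: (xi :\: A) = xi by rewrite -{1}(setIidPr sAxi) setID.
have ltDxi : #|xi :\: A| < #|xi|.
  by rewrite -(cardsID A xi) (setIidPr sAxi) -[ltnLHS]add0n ltn_add2r card_gt0.
have [|||n [E expE]] := IHm (apply_star T A) (xi :\: A).
- exact: leq_trans ltDxi _.
- split; first exact: consistent_sub (subsetDl _ _) cxi.
  by rewrite -apply_starU ?defxi.
(* Applying [B] after [A] amounts to applying [A :|: B], still a proper subset of [xi], so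
   irredundance of [xi] excludes it. *)
- move=> B ltB; have sB := proper_sub ltB.
  have ltAB : A :|: B \proper xi.
    rewrite properE subUset sAxi (subset_trans sB (subsetDl _ _)) /=.
    apply: contra (proper_subn ltB) => sxiAB.
    by rewrite subDset.
  rewrite -apply_starU; [exact: irr | | exact: disjointWr sB dA].
  exact: consistent_sub (proper_sub ltAB) cxi.
have cAD : consistent (A :|: (xi :\: A)) by rewrite defxi.
have := explanation_cons cAD dA (conj jA minA) expE.
by rewrite defxi => expxi; exists n.+1; eexists; apply: expxi.
Qed.

End Explanation.

Theorem theorem2 (I O S : finType) (phi : ltl (I + O)%type)
    (T : tsystem I O S) (xi : transformation I O S) :
  minimal_repair phi T xi ->
  exists (n : nat) (E : 'I_n -> transformation I O S * word (I + O)%type),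
    explanation phi T xi E.
Proof.
move=> [rep_xi min_xi]; apply: explanation_ex => // A ltA mA; apply: min_xi.
exists A; last exact: proper_card ltA.
by split=> //; apply: consistent_sub (proper_sub ltA) rep_xi.1.
Qed.
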